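(* Let $S$ and $T$ be finite non-empty symmetric normalized sets of integers. If $\Sigma_S = \Sigma_T$ and $k$ is an integer in the open interval $(1, 2\sqrt{\max(S)}+1)$, then $k \in S$ if and only if $k \in T$.
   Context: $\mathbb{D}$ is the open unit disc in $\mathbb{C}$. For a non-empty bounded set $S$ of complex numbers, $\Sigma_S = \{ z \in \mathbb{D} \mid \exists\, p_0, p_1, \ldots \in S,\ p_0 \neq 0,\ \sum_{j=0}^\infty p_j z^j = 0 \}$. A set $S$ is symmetric if $S = -S$. A finite non-empty set $S$ of real numbers is normalized if $1 \in S$ and $|s| \geqslant 1$ for every $s \in S$ with $s \neq 0$. *)

(* Defs.v *)
From Stdlib Require Export Reals ZArith Ensembles Finite_sets Image.
From Stdlib Require Import Lia.
From Coquelicot Require Export Coquelicot.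
Local Open Scope R_scope.

(* The names [Finite], [Im] and [C] exist both in the Stdlib and in Coquelicot:
   the set-theoretic ones are written [Finite_sets.Finite] and [Image.Im];
   [C] is the type of complex numbers. *)

Definition Zset_R (S : Ensemble Z) : Ensemble R := Image.Im Z R S IZR.

Definition Zset_C (S : Ensemble Z) : Ensemble C :=
  Image.Im Z C S (fun n => RtoC (IZR n)).

(* Zeros in the open unit disc of power series with coefficients in S and
   non-zero constant term. *)
Definition Sigma (S : Ensemble C) : Ensemble C :=
  fun z => Cmod z < 1 /\
    exists p : nat -> C,
      (forall j, In C S (p j)) /\ p 0%nat <> RtoC 0 /\
      @is_pseries C_AbsRing C_NormedModule p z (RtoC 0).

Definition symmetric (S : Ensemble Z) : Prop :=
  Same_set Z S (Image.Im Z Z S Z.opp).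

Definition normalized (S : Ensemble R) : Prop :=
  Finite_sets.Finite R S /\ Inhabited R S /\
  In R S 1 /\ (forall s, In R S s -> s <> 0 -> 1 <= Rabs s).

Definition is_max (S : Ensemble Z) (m : Z) : Prop :=
  In Z S m /\ (forall s, In Z S s -> (s <= m)%Z).

Lemma is_max_exists_unique (S : Ensemble Z) :
  Finite_sets.Finite Z S -> Inhabited Z S -> exists! m, is_max S m.
Proof.
intros HF [x0 Hx0].
assert (H : (forall x, ~ In Z S x) \/ exists m, is_max S m).
{ clear x0 Hx0; induction HF as [|A HA IH x Hx].
  - left; intros x [].
  - right; destruct IH as [IH | [m [Hm Hmax]]].
    + exists x; split; [right; constructor|].
      intros s [s' Hs|s' Hs]; [destruct (IH s' Hs)|destruct Hs; lia].
    + destruct (Z_le_gt_dec x m) as [Hle|Hgt].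
      * exists m; split; [left; exact Hm|].
        intros s [s' Hs|s' Hs]; [exact (Hmax s' Hs)|destruct Hs; lia].
      * exists x; split; [right; constructor|].
        intros s [s' Hs|s' Hs]; [specialize (Hmax s' Hs); lia|destruct Hs; lia]. }
destruct H as [H|[m [Hm Hmax]]]; [destruct (H x0 Hx0)|].
exists m; split; [split; assumption|].
intros m' [Hm' Hmax'].
specialize (Hmax m' Hm'); specialize (Hmax' m Hm); lia.
Qed.

(* Main.v *)
Require Import Defs.
From Stdlib Require Import Reals ZArith Ensembles Finite_sets Image Lra Lia.
From Coquelicot Require Import Coquelicot.
Open Scope R_scope.

(** The largest element [m] of [S] can be read off from the zeros: if
    [p_0 + p_1 z + ... = 0] with [|p_0| >= 1] and [|p_j| <= m], then
    [|z| >= 1 / (m + 1)], and the bound is attained at the real point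
    [1 / (m + 1)], where [1 - m z - m z^2 - ... = 0]. Hence [S] and [T] have the
    same maximum [m] ([Sigma_max_le]).

    To detect a smaller digit [k], look for a zero at which every coefficient is
    forced. Write [z = r e^(i t)] with [0 < t < pi]. Dividing the series by [z] and
    taking imaginary parts makes the real number [p_1] disappear:
    [p_0 sin t / r = sum_(j >= 1) p_(j+1) r^j sin (j t)]. On the curve
    [sin t / r = m sum_(j >= 1) r^j |sin (j t)|] this identity is an extremal
    case of the triangle inequality: it forces [p_0 = +-1] and, whenever
    [sin (j t) <> 0], also [p_(j+1) = p_0 m sign (sin (j t))]. If no [sin (j t)]
    vanishes, then the real parts determine [p_1] as well: it is [- p_0] times
    [G t = cos t / r + m sum_(j >= 1) r^j sign (sin (j t)) cos (j t)].
    So a point of the curve with [G t = k] and no [sin (j t) = 0] is a zero for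
    digits in [S] as soon as [k] is in [S], and it is a zero for digits in [T] only
    if [k] or [-k] is in [T] ([Sigma_transfer]).

    If [m = 1], there is no digit [k > 1] to detect. If [m > 1], such a point exists
    for every real [k] in [(1, 2 sqrt m + 1)] ([curve_crossing]).
    For each [t] the curve has exactly one [r], which depends continuously on [t]. The
    function [G] is not continuous: when [j t] crosses a
    multiple of [pi], the factor [sign (sin (j t)) cos (j t)] jumps. But it always
    jumps upwards, from [-1] to [1]. With the value [1] chosen at the jumps, [G]
    becomes right-continuous, and its left limit is obtained by choosing
    [-1] instead. Moreover [G 0 = 2 sqrt m + 1] and [G (pi / 2) = 1]. At the first
    [t] with [G t <= k], the left limit is at least [k] and the value at most
    [k]; since jumps go upwards, both equal [k] and there is no jump at [t], that
    is, no [sin (j t)] vanishes. The angle [0] is included by dividing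
    [sin (j t)] by [sin t] throughout. *)

(** * Series depending on a parameter *)

Lemma ex_series_abs_le (a b : nat -> R) :
  ex_series b -> (forall n, Rabs (a n) <= b n) -> ex_series a.
Proof.
intros Hb Hab. exact (ex_series_le (K := R_AbsRing) (V := R_CompleteNormedModule) a b Hab Hb).
Qed.

Lemma Series_tail_le (a b : nat -> R) (N : nat) :
  ex_series b -> (forall n, Rabs (a n) <= b n) ->
  Rabs (Series a - sum_n a N) <= Series b - sum_n b N.
Proof.
intros Hb Hab.
assert (Ha : ex_series a) by exact (ex_series_abs_le a b Hb Hab).
rewrite (Series_incr_n a (S N)), (Series_incr_n b (S N)); try lia; try assumption.
simpl Init.Nat.pred. rewrite !sum_n_Reals.
assert (Hb' : ex_series (fun k => b (S N + k)%nat)) by now apply ex_series_incr_n.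
assert (Ha' : ex_series (fun k => Rabs (a (S N + k)%nat))).
{ apply (ex_series_abs_le _ (fun k => b (S N + k)%nat)); [exact Hb'|].
  intros n; rewrite Rabs_Rabsolu; apply Hab. }
match goal with |- Rabs ?x <= ?y =>
  replace x with (Series (fun k => a (S N + k)%nat)) by ring;
  replace y with (Series (fun k => b (S N + k)%nat)) by ring end.
eapply Rle_trans; [exact (Series_Rabs _ Ha')|].
apply Series_le; [|exact Hb'].
intros n; split; [apply Rabs_pos|apply Hab].
Qed.

Lemma filterlim_sum_n {X : Type} (F : (X -> Prop) -> Prop) {FF : Filter F}
  (a : X -> nat -> R) (l : nat -> R) (N : nat) :
  (forall n, filterlim (fun x => a x n) F (locally (l n))) ->
  filterlim (fun x => sum_n (a x) N) F (locally (sum_n l N)).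
Proof.
intros H; induction N as [|N IH].
- apply filterlim_ext with (fun x => a x 0%nat).
  + intros x; now rewrite sum_O.
  + rewrite sum_O; apply H.
- apply filterlim_ext with (fun x => plus (sum_n (a x) N) (a x (S N))).
  + intros x; now rewrite sum_Sn.
  + rewrite sum_Sn.
    apply (filterlim_comp_2 (G := locally (sum_n l N)) (H := locally (l (S N))));
      [exact IH|apply H|].
    apply (filterlim_plus (K := R_AbsRing) (V := R_NormedModule)).
Qed.

Lemma filterlim_R_eps {X : Type} (F : (X -> Prop) -> Prop) {FF : Filter F}
  (f : X -> R) (l : R) :
  filterlim f F (locally l) <->
  (forall eps, 0 < eps -> F (fun x => Rabs (f x - l) < eps)).
Proof.
split; intros H.
- intros eps Heps. exact (proj1 (filterlim_locally f l) H (mkposreal eps Heps)).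
- apply filterlim_locally; intros [eps Heps]. exact (H eps Heps).
Qed.

(** Tannery's theorem: the majorant [b] makes the tails of all the series
    uniformly small, so that only finitely many terms matter for the limit. *)
Lemma filterlim_Series {X : Type} (F : (X -> Prop) -> Prop) {FF : Filter F}
  (a : X -> nat -> R) (b l : nat -> R) :
  ex_series b ->
  F (fun x => forall n, Rabs (a x n) <= b n) ->
  (forall n, Rabs (l n) <= b n) ->
  (forall n, filterlim (fun x => a x n) F (locally (l n))) ->
  filterlim (fun x => Series (a x)) F (locally (Series l)).
Proof.
intros Hb Hab Hlb Hlim.
apply filterlim_R_eps; [exact FF|]; intros eps Heps.
assert (H3 : 0 < eps / 3) by lra.
assert (HN : exists N, Series b - sum_n b N < eps / 3).
{ destruct (proj1 (filterlim_R_eps _ _ _) (Series_correct b Hb) _ H3) as [N HN].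
  exists N. specialize (HN N (Nat.le_refl N)).
  rewrite sum_n_Reals in *; apply Rabs_def2 in HN; lra. }
destruct HN as [N HN].
generalize (proj1 (filterlim_R_eps _ _ _) (filterlim_sum_n F a l N Hlim) _ H3).
intros Hs. generalize (filter_and _ _ Hab Hs). apply filter_imp.
intros x [Hx Hball].
generalize (Series_tail_le (a x) b N Hb Hx) (Series_tail_le l b N Hb Hlb); intros T1 T2.
rewrite !sum_n_Reals in *; apply Rabs_def2 in Hball.
apply Rabs_le_between in T1; apply Rabs_le_between in T2.
apply Rabs_def1; lra.
Qed.

Lemma Series_nonneg (a : nat -> R) :
  ex_series a -> (forall n, 0 <= a n) -> 0 <= Series a.
Proof.
intros Ha H0.
replace 0 with (Series (fun n => 0 * a n)) by (rewrite Series_scal_l; ring).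
apply Series_le; [|exact Ha].
intros n; specialize (H0 n); lra.
Qed.

Lemma Series_nonneg_ge_term (a : nat -> R) (n : nat) :
  ex_series a -> (forall m, 0 <= a m) -> a n <= Series a.
Proof.
intros Ha H0.
assert (Hs : 0 <= Series (fun k => a (S n + k)%nat)).
{ apply Series_nonneg; [now apply ex_series_incr_n|intros m; apply H0]. }
rewrite (Series_incr_n a (S n)); [|lia|assumption]; simpl Init.Nat.pred.
enough (a n <= sum_f_R0 a n) by lra.
destruct n as [|n]; simpl; [lra|].
enough (0 <= sum_f_R0 a n) by lra.
now apply cond_pos_sum.
Qed.

(** Ratio test. *)
Lemma ex_series_INR_pow (r : R) :
  0 < r < 1 -> ex_series (fun n => INR n * r ^ n).
Proof.
intros Hr.
apply ex_series_incr_1.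
apply ex_series_Rabs, ex_series_DAlembert with r.
- lra.
- intros n. apply Rmult_integral_contrapositive_currified.
  + apply not_0_INR; lia.
  + apply pow_nonzero; lra.
- apply is_lim_seq_ext with (fun n => r * (1 + / INR (S n))).
  + intros n. rewrite Rabs_right.
    * rewrite !S_INR; simpl; field.
      split; [apply pow_nonzero; lra|]. generalize (pos_INR n); lra.
    * apply Rle_ge, Rlt_le, Rdiv_lt_0_compat;
        apply Rmult_lt_0_compat; try apply pow_lt; try lra; apply lt_0_INR; lia.
  + replace (Finite r) with (Rbar_mult r (Rbar_plus 1 0)) by (simpl; f_equal; ring).
    apply is_lim_seq_scal_l.
    apply is_lim_seq_plus'; [apply is_lim_seq_const|].
    apply (is_lim_seq_incr_1 (fun n => / INR n)).
    apply is_lim_seq_inv with (l := p_infty); [apply is_lim_seq_INR|discriminate].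
Qed.

(** The sum [s] of [n r^n] satisfies [s = r s + r / (1 - r)], by an index shift. *)
Lemma Series_INR_pow (r : R) :
  0 < r < 1 -> Series (fun n => INR n * r ^ S n) = (r / (1 - r)) ^ 2.
Proof.
intros Hr.
assert (Hex := ex_series_INR_pow r Hr).
assert (Hg : ex_series (fun n => r ^ n)) by (apply ex_series_geom; rewrite Rabs_right; lra).
assert (E : Series (fun n => INR n * r ^ n)
            = r * Series (fun n => INR n * r ^ n) + r * / (1 - r)).
{ rewrite (Series_incr_1 _ Hex) at 1.
  rewrite <- (Series_geom r) by (rewrite Rabs_right; lra).
  rewrite <- !Series_scal_l, <- Series_plus.
  - simpl (INR 0); rewrite Rmult_0_l, Rplus_0_l.
    apply Series_ext; intros n; rewrite S_INR; simpl; ring.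
  - exact (ex_series_scal_l (K := R_AbsRing) (V := R_NormedModule) r _ Hex).
  - exact (ex_series_scal_l (K := R_AbsRing) (V := R_NormedModule) r _ Hg). }
assert (E2 : Series (fun n => INR n * r ^ n) = r / (1 - r) ^ 2).
{ apply Rmult_eq_reg_l with (1 - r); [|lra].
  transitivity (r * / (1 - r)); [lra|]. field; lra. }
transitivity (r * Series (fun n => INR n * r ^ n)).
- rewrite <- Series_scal_l. apply Series_ext; intros n; simpl; ring.
- rewrite E2; field; lra.
Qed.

Lemma filterlim_pow {X : Type} (F : (X -> Prop) -> Prop) {FF : Filter F}
  (r : X -> R) (r0 : R) (n : nat) :
  filterlim r F (locally r0) -> filterlim (fun x => r x ^ n) F (locally (r0 ^ n)).
Proof.
intros H. apply (filterlim_comp _ _ _ r (fun y => y ^ n) F (locally r0)); [exact H|].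
apply (ex_derive_continuous (K := R_AbsRing) (V := R_NormedModule) (fun y => y ^ n)).
auto_derive; exact I.
Qed.

Lemma filterlim_Rmult {X : Type} (F : (X -> Prop) -> Prop) {FF : Filter F}
  (f g : X -> R) (a b : R) :
  filterlim f F (locally a) -> filterlim g F (locally b) ->
  filterlim (fun x => f x * g x) F (locally (a * b)).
Proof.
intros Hf Hg.
apply (filterlim_comp_2 (G := locally a) (H := locally b)); [exact Hf|exact Hg|].
apply (filterlim_mult (K := R_AbsRing)).
Qed.

Lemma filterlim_Rplus {X : Type} (F : (X -> Prop) -> Prop) {FF : Filter F}
  (f g : X -> R) (a b : R) :
  filterlim f F (locally a) -> filterlim g F (locally b) ->
  filterlim (fun x => f x + g x) F (locally (a + b)).
Proof.
intros Hf Hg.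
apply (filterlim_comp_2 (G := locally a) (H := locally b)); [exact Hf|exact Hg|].
apply (filterlim_plus (K := R_AbsRing) (V := R_NormedModule)).
Qed.

Lemma is_series_ext_R (a b : nat -> R) (l : R) :
  (forall n, a n = b n) -> is_series a l -> is_series b l.
Proof. exact (is_series_ext (K := R_AbsRing) (V := R_NormedModule) a b l). Qed.

Lemma is_series_scal_R (c : R) (a : nat -> R) (l : R) :
  is_series a l -> is_series (fun n => c * a n) (c * l).
Proof. exact (is_series_scal (K := R_AbsRing) (V := R_NormedModule) c a l). Qed.

Lemma is_series_plus_R (a b : nat -> R) (la lb : R) :
  is_series a la -> is_series b lb -> is_series (fun n => a n + b n) (la + lb).
Proof. exact (is_series_plus (K := R_AbsRing) (V := R_NormedModule) a b la lb). Qed.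

Lemma is_series_shift_R (a : nat -> R) (l : R) :
  is_series a l <-> is_series (fun n => a (S n)) (l - a 0%nat).
Proof.
split; intros H.
- apply (is_series_incr_1 (K := R_AbsRing) (V := R_NormedModule) a).
  unfold plus; simpl. now replace (l - a 0%nat + a 0%nat) with l by ring.
- exact (is_series_decr_1 (K := R_AbsRing) (V := R_NormedModule) a l H).
Qed.

Lemma sign_cases (x : R) : x <> 0 -> (0 < x /\ sign x = 1) \/ (x < 0 /\ sign x = -1).
Proof.
intros Hx. destruct (Rtotal_order x 0) as [H|[H|H]].
- right; split; [exact H|now apply sign_eq_m1].
- contradiction.
- left; split; [exact H|now apply sign_eq_1].
Qed.

(** * The quotients sin (j t) / sin t *)

(** The Chebyshev quotient [sin (j t) / sin t], by a recursion that makes sense at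
    [t = 0] too and shows at once that it is continuous and bounded by [j]. *)
Fixpoint sin_ratio (j : nat) (t : R) : R :=
  match j with
  | O => 0
  | S j => cos (INR j * t) + cos t * sin_ratio j t
  end.

Lemma sin_ratio_spec (j : nat) (t : R) : sin (INR j * t) = sin t * sin_ratio j t.
Proof.
induction j as [|j IH]; [simpl; rewrite Rmult_0_l, sin_0; ring|].
rewrite S_INR. replace ((INR j + 1) * t) with (INR j * t + t) by ring.
rewrite sin_plus, IH; simpl; ring.
Qed.

Lemma sin_ratio_abs_le (j : nat) (t : R) : Rabs (sin_ratio j t) <= INR j.
Proof.
induction j as [|j IH]; [simpl; rewrite Rabs_R0; lra|].
rewrite S_INR; simpl sin_ratio.
eapply Rle_trans; [apply Rabs_triang|]. rewrite Rabs_mult.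
generalize (COS_bound (INR j * t)) (COS_bound t) (Rabs_pos (sin_ratio j t)); intros C1 C2 C3.
assert (Rabs (cos (INR j * t)) <= 1) by (apply Rabs_le; lra).
assert (Rabs (cos t) <= 1) by (apply Rabs_le; lra).
nra.
Qed.

Lemma sin_ratio_0 (j : nat) : sin_ratio j 0 = INR j.
Proof.
induction j as [|j IH]; [reflexivity|].
rewrite S_INR; simpl sin_ratio; rewrite Rmult_0_r, cos_0, IH; ring.
Qed.

Lemma continuous_cos_mult (j : nat) (t : R) : continuous (fun x => cos (INR j * x)) t.
Proof.
apply (ex_derive_continuous (K := R_AbsRing) (V := R_NormedModule)).
auto_derive; exact I.
Qed.

Lemma continuous_sin_ratio (j : nat) (t : R) : continuous (sin_ratio j) t.
Proof.
induction j as [|j IH]; [apply continuous_const|].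
simpl. apply (continuous_plus (V := R_NormedModule)).
- apply continuous_cos_mult.
- apply (continuous_mult (K := R_AbsRing)); [|exact IH].
  apply continuous_cos.
Qed.

(** * Sign of sin (j t) times cos (j t) *)

(** The number [e] is the value given to [sign (sin (j t)) cos (j t)] at the jumps:
    [e = 1] gives the right limit there and [e = -1] the left limit. *)
Definition signed_cos (e : R) (j : nat) (t : R) : R :=
  if Req_EM_T (sin_ratio j t) 0 then e
  else sign (sin_ratio j t) * cos (INR j * t).

Lemma signed_cos_abs_le (e : R) (j : nat) (t : R) :
  Rabs e <= 1 -> Rabs (signed_cos e j t) <= 1.
Proof.
intros He; unfold signed_cos.
destruct (Req_EM_T (sin_ratio j t) 0) as [H|H]; [exact He|].
generalize (COS_bound (INR j * t)); intros C.
destruct (sign_cases _ H) as [[_ E]|[_ E]]; rewrite E; apply Rabs_le; lra.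
Qed.

Lemma filterlim_signed_cos_continuous (F : (R -> Prop) -> Prop) {FF : Filter F}
  (e e' : R) (j : nat) (c : R) :
  filter_le F (locally c) -> sin_ratio j c <> 0 ->
  filterlim (signed_cos e j) F (locally (signed_cos e' j c)).
Proof.
intros HF Hc.
assert (Hcos : filterlim (fun t => sign (sin_ratio j c) * cos (INR j * t)) F
                 (locally (sign (sin_ratio j c) * cos (INR j * c)))).
{ apply filterlim_filter_le_1 with (1 := HF).
  exact (continuous_scal_r (K := R_AbsRing) (V := R_NormedModule) (sign (sin_ratio j c))
           (fun t => cos (INR j * t)) c (continuous_cos_mult j c)). }
assert (Hsgn : F (fun t => sin_ratio j t <> 0
                           /\ sign (sin_ratio j t) = sign (sin_ratio j c))).
{ apply HF.
  destruct (proj1 (filterlim_R_eps _ _ _) (continuous_sin_ratio j c)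
              (Rabs (sin_ratio j c)) (Rabs_pos_lt _ Hc)) as [d Hd].
  exists d; intros t Ht; specialize (Hd t Ht); revert Hd.
  destruct (sign_cases _ Hc) as [[H E]|[H E]]; rewrite E.
  - rewrite (Rabs_right (sin_ratio j c)) by lra; intros Hd; apply Rabs_def2 in Hd.
    split; [lra|apply sign_eq_1; lra].
  - rewrite (Rabs_left (sin_ratio j c)) by lra; intros Hd; apply Rabs_def2 in Hd.
    split; [lra|apply sign_eq_m1; lra]. }
replace (signed_cos e' j c) with (sign (sin_ratio j c) * cos (INR j * c)).
- apply filterlim_ext_loc with (2 := Hcos).
  apply filter_imp with (2 := Hsgn); intros t [Ht E]; unfold signed_cos.
  destruct (Req_EM_T (sin_ratio j t) 0); [contradiction|now rewrite E].
- unfold signed_cos. destruct (Req_EM_T (sin_ratio j c) 0); [contradiction|reflexivity].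
Qed.

(** The sign of [sin (j t) cos (j t)], which is half of [sin (2 j t)], decides
    whether the cosine has the same sign as the sine. *)
Lemma signed_cos_pos (e : R) (j : nat) (t : R) :
  0 < sin t -> 0 < sin (2 * (INR j * t)) -> signed_cos e j t = Rabs (cos (INR j * t)).
Proof.
rewrite sin_2a, sin_ratio_spec; intros Ht H; unfold signed_cos.
assert (H' : 0 < sin_ratio j t * cos (INR j * t)).
{ apply Rmult_lt_reg_l with (2 * sin t); lra. }
destruct (Req_EM_T (sin_ratio j t) 0) as [E|E]; [rewrite E in H'; lra|].
destruct (sign_cases _ E) as [[P Q]|[P Q]]; rewrite Q.
- rewrite Rabs_right; nra.
- rewrite Rabs_left; nra.
Qed.

Lemma signed_cos_neg (e : R) (j : nat) (t : R) :
  0 < sin t -> sin (2 * (INR j * t)) < 0 -> signed_cos e j t = - Rabs (cos (INR j * t)).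
Proof.
rewrite sin_2a, sin_ratio_spec; intros Ht H; unfold signed_cos.
assert (H' : sin_ratio j t * cos (INR j * t) < 0).
{ apply Rmult_lt_reg_l with (2 * sin t); lra. }
destruct (Req_EM_T (sin_ratio j t) 0) as [E|E]; [rewrite E in H'; lra|].
destruct (sign_cases _ E) as [[P Q]|[P Q]]; rewrite Q.
- rewrite Rabs_left; nra.
- rewrite Rabs_right; nra.
Qed.

Lemma sin_ratio_eq_0 (j : nat) (c : R) : sin_ratio j c = 0 ->
  sin (2 * (INR j * c)) = 0 /\ cos (2 * (INR j * c)) = 1 /\ Rabs (cos (INR j * c)) = 1.
Proof.
intros H.
assert (Hs : sin (INR j * c) = 0) by (rewrite sin_ratio_spec, H; ring).
split; [|split].
- rewrite sin_2a, Hs; ring.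
- rewrite cos_2a_sin, Hs; ring.
- generalize (sin2_cos2 (INR j * c)); unfold Rsqr; rewrite Hs; intros E.
  destruct (Rcase_abs (cos (INR j * c))).
  + rewrite Rabs_left by assumption; nra.
  + rewrite Rabs_right by assumption; nra.
Qed.

Lemma filterlim_abs_cos (F : (R -> Prop) -> Prop) {FF : Filter F} (j : nat) (c : R) :
  filter_le F (locally c) ->
  filterlim (fun t => Rabs (cos (INR j * t))) F (locally (Rabs (cos (INR j * c)))).
Proof.
intros HF. apply filterlim_filter_le_1 with (1 := HF).
apply (continuous_comp (fun t => cos (INR j * t)) Rabs);
  [apply continuous_cos_mult|apply continuous_Rabs].
Qed.

(** To the right of a zero [c] of [sin (j t)] the double angle [2 j t] has just
    passed a multiple of [2 pi], so [sin (2 j t) > 0] and [signed_cos] is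
    [|cos (j t)|], which tends to [1]. *)
Lemma filterlim_signed_cos_right (j : nat) (c : R) :
  (0 < j)%nat -> 0 <= c < PI ->
  filterlim (signed_cos 1 j) (at_right c) (locally (signed_cos 1 j c)).
Proof.
intros Hj Hc.
assert (HF : filter_le (at_right c) (locally c)) by apply filter_le_within.
assert (Hj' : 0 < INR j) by now apply lt_0_INR.
destruct (Req_dec (sin_ratio j c) 0) as [E|E];
  [|exact (filterlim_signed_cos_continuous _ _ _ j c HF E)].
assert (Hc0 : 0 < c).
{ destruct (Req_dec c 0) as [Z|Z]; [|lra].
  rewrite Z, sin_ratio_0 in E; lra. }
destruct (sin_ratio_eq_0 j c E) as [S0 [C1 A1]].
replace (signed_cos 1 j c) with (Rabs (cos (INR j * c)))
  by (rewrite A1; unfold signed_cos; destruct (Req_EM_T (sin_ratio j c) 0); [lra|contradiction]).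
apply filterlim_ext_loc with (2 := filterlim_abs_cos _ j c HF).
assert (Hd : 0 < Rmin (PI - c) (PI / (2 * INR j))).
{ apply Rmin_glb_lt; [lra|]. apply Rdiv_lt_0_compat; lra. }
exists (mkposreal _ Hd); intros t Ht Hct.
apply Rabs_def2 in Ht; simpl in Ht; unfold minus, plus, opp in Ht; simpl in Ht.
generalize (Rmin_l (PI - c) (PI / (2 * INR j))) (Rmin_r (PI - c) (PI / (2 * INR j))); intros L1 L2.
symmetry; apply signed_cos_pos; [apply sin_gt_0; lra|].
replace (2 * (INR j * t)) with (2 * (INR j * c) + 2 * INR j * (t - c)) by ring.
rewrite sin_plus, S0, C1.
assert (2 * INR j * (t - c) < PI).
{ apply Rlt_le_trans with (2 * INR j * (PI / (2 * INR j))).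
  - apply Rmult_lt_compat_l; lra.
  - right; field; lra. }
generalize (sin_gt_0 (2 * INR j * (t - c))); intros P.
assert (0 < 2 * INR j * (t - c)) by (apply Rmult_lt_0_compat; lra).
lra.
Qed.

(** To the left of a zero of [sin (j t)] one has [sin (2 j t) < 0] instead, hence
    the limit [-1]: every jump goes upwards. *)
Lemma filterlim_signed_cos_left (j : nat) (c : R) :
  (0 < j)%nat -> 0 < c < PI ->
  filterlim (signed_cos 1 j) (at_left c) (locally (signed_cos (-1) j c)).
Proof.
intros Hj Hc.
assert (HF : filter_le (at_left c) (locally c)) by apply filter_le_within.
assert (Hj' : 0 < INR j) by now apply lt_0_INR.
destruct (Req_dec (sin_ratio j c) 0) as [E|E];
  [|exact (filterlim_signed_cos_continuous _ _ _ j c HF E)].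
destruct (sin_ratio_eq_0 j c E) as [S0 [C1 A1]].
replace (signed_cos (-1) j c) with (- Rabs (cos (INR j * c)))
  by (rewrite A1; unfold signed_cos; destruct (Req_EM_T (sin_ratio j c) 0); [lra|contradiction]).
apply filterlim_ext_loc with (f := fun t => opp (Rabs (cos (INR j * t)))).
2: { apply (filterlim_comp _ _ _ (fun t => Rabs (cos (INR j * t))) opp _ (locally (Rabs (cos (INR j * c))))).
     - exact (filterlim_abs_cos _ j c HF).
     - apply (filterlim_opp (K := R_AbsRing) (V := R_NormedModule)). }
assert (Hd : 0 < Rmin c (PI / (2 * INR j))).
{ apply Rmin_glb_lt; [lra|]. apply Rdiv_lt_0_compat; lra. }
exists (mkposreal _ Hd); intros t Ht Hct.
apply Rabs_def2 in Ht; simpl in Ht; unfold minus, plus, opp in Ht; simpl in Ht.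
generalize (Rmin_l c (PI / (2 * INR j))) (Rmin_r c (PI / (2 * INR j))); intros L1 L2.
symmetry; apply signed_cos_neg; [apply sin_gt_0; lra|].
replace (2 * (INR j * t)) with (2 * (INR j * c) - 2 * INR j * (c - t)) by ring.
rewrite sin_minus, S0, C1.
assert (2 * INR j * (c - t) < PI).
{ apply Rlt_le_trans with (2 * INR j * (PI / (2 * INR j))).
  - apply Rmult_lt_compat_l; lra.
  - right; field; lra. }
generalize (sin_gt_0 (2 * INR j * (c - t))); intros P.
assert (0 < 2 * INR j * (c - t)) by (apply Rmult_lt_0_compat; lra).
lra.
Qed.

(** * The extremal curve *)

(** Equal to [(r / sin t) * sum_j r^j |sin (j t)|] when [sin t > 0], so that the
    extremal curve is [sin_sum r t = / M]. *)
Definition sin_sum (r t : R) : R :=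
  Series (fun n => Rabs (sin_ratio n t) * r ^ S n).

Definition cos_sum (e r t : R) : R :=
  Series (fun n => signed_cos e (S n) t * r ^ S n).

Lemma ex_series_sin_majorant (rho : R) : 0 < rho < 1 -> ex_series (fun n => INR n * rho ^ S n).
Proof.
intros H. apply ex_series_ext with (fun n => rho * (INR n * rho ^ n)).
- intros n; simpl; ring.
- exact (ex_series_scal_l (K := R_AbsRing) (V := R_NormedModule) rho _ (ex_series_INR_pow rho H)).
Qed.

Lemma ex_series_cos_majorant (rho : R) : 0 < rho < 1 -> ex_series (fun n => rho ^ S n).
Proof.
intros H. apply (ex_series_incr_1 (fun n => rho ^ n)), ex_series_geom.
rewrite Rabs_right; lra.
Qed.

Lemma pow_le_majorant (r rho : R) (n : nat) : 0 <= r <= rho -> 0 <= r ^ n <= rho ^ n.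
Proof. intros H; split; [apply pow_le; lra|apply pow_incr; lra]. Qed.

Lemma sin_term_le (r rho t : R) (n : nat) : 0 <= r <= rho ->
  Rabs (Rabs (sin_ratio n t) * r ^ S n) <= INR n * rho ^ S n.
Proof.
intros H. destruct (pow_le_majorant r rho (S n) H) as [H1 H2].
rewrite Rabs_mult, Rabs_Rabsolu, (Rabs_right (r ^ S n)) by lra.
apply Rmult_le_compat; [apply Rabs_pos|lra|apply sin_ratio_abs_le|lra].
Qed.

Lemma cos_term_le (e r rho t : R) (n : nat) : Rabs e <= 1 -> 0 <= r <= rho ->
  Rabs (signed_cos e (S n) t * r ^ S n) <= rho ^ S n.
Proof.
intros He H. destruct (pow_le_majorant r rho (S n) H) as [H1 H2].
rewrite Rabs_mult, (Rabs_right (r ^ S n)) by lra.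
rewrite <- (Rmult_1_l (rho ^ S n)).
apply Rmult_le_compat; [apply Rabs_pos|lra|now apply signed_cos_abs_le|lra].
Qed.

Lemma ex_sin_sum (r t : R) : 0 <= r < 1 ->
  ex_series (fun n => Rabs (sin_ratio n t) * r ^ S n).
Proof.
intros H. apply (ex_series_abs_le _ (fun n => INR n * ((r + 1) / 2) ^ S n)).
- apply ex_series_sin_majorant; lra.
- intros n; apply sin_term_le; lra.
Qed.

Lemma ex_cos_sum (e r t : R) : Rabs e <= 1 -> 0 <= r < 1 ->
  ex_series (fun n => signed_cos e (S n) t * r ^ S n).
Proof.
intros He H. apply (ex_series_abs_le _ (fun n => ((r + 1) / 2) ^ S n)).
- apply ex_series_cos_majorant; lra.
- intros n; apply cos_term_le; [exact He|lra].
Qed.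

Lemma filterlim_sin_sum {X : Type} (F : (X -> Prop) -> Prop) {FF : Filter F}
  (r t : X -> R) (r0 t0 rho : R) :
  0 < rho < 1 -> F (fun x => 0 <= r x <= rho) -> 0 <= r0 <= rho ->
  filterlim r F (locally r0) -> filterlim t F (locally t0) ->
  filterlim (fun x => sin_sum (r x) (t x)) F (locally (sin_sum r0 t0)).
Proof.
intros Hrho HF Hr0 Hr Ht.
apply (filterlim_Series F (fun x n => Rabs (sin_ratio n (t x)) * r x ^ S n)
         (fun n => INR n * rho ^ S n)).
- now apply ex_series_sin_majorant.
- apply filter_imp with (2 := HF); intros x Hx n; now apply sin_term_le.
- intros n; now apply sin_term_le.
- intros n. apply filterlim_Rmult; [exact FF| |now apply filterlim_pow].
  apply (filterlim_comp _ _ _ t (fun y => Rabs (sin_ratio n y)) F (locally t0)); [exact Ht|].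
  apply (continuous_comp (sin_ratio n) Rabs);
    [apply continuous_sin_ratio|apply continuous_Rabs].
Qed.

Lemma sin_sum_0 (t : R) : sin_sum 0 t = 0.
Proof.
unfold sin_sum. rewrite (Series_ext _ (fun n => 0 * 0)) by (intros n; simpl; ring).
rewrite Series_scal_l; ring.
Qed.

(** The term of index 1 alone, since [sin_ratio 1] is identically 1. *)
Lemma sin_sum_ge_sqr (r t : R) : 0 <= r < 1 -> r ^ 2 <= sin_sum r t.
Proof.
intros Hr.
replace (r ^ 2) with (Rabs (sin_ratio 1 t) * r ^ 2).
- apply (Series_nonneg_ge_term (fun n => Rabs (sin_ratio n t) * r ^ S n) 1).
  + now apply ex_sin_sum.
  + intros n; apply Rmult_le_pos; [apply Rabs_pos|apply pow_le; lra].
- simpl (sin_ratio 1 t). rewrite Rmult_0_l, cos_0, Rmult_0_r, Rplus_0_r, Rabs_R1; ring.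
Qed.

(** All terms are nondecreasing in [r], and the term of index 1 is [r^2], which
    increases strictly. *)
Lemma sin_sum_lt (a b t : R) : 0 <= a < b -> b < 1 -> sin_sum a t < sin_sum b t.
Proof.
intros Hab Hb.
assert (Ea : ex_series (fun n => Rabs (sin_ratio n t) * a ^ S n)) by (apply ex_sin_sum; lra).
assert (Eb : ex_series (fun n => Rabs (sin_ratio n t) * b ^ S n)) by (apply ex_sin_sum; lra).
enough (b ^ 2 - a ^ 2 <= sin_sum b t - sin_sum a t) by nra.
unfold sin_sum; rewrite <- Series_minus by assumption.
replace (b ^ 2 - a ^ 2)
  with (Rabs (sin_ratio 1 t) * b ^ 2 - Rabs (sin_ratio 1 t) * a ^ 2).
- apply (Series_nonneg_ge_term (fun n => Rabs (sin_ratio n t) * b ^ S n - Rabs (sin_ratio n t) * a ^ S n) 1).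
  + exact (ex_series_minus (K := R_AbsRing) (V := R_NormedModule) _ _ Eb Ea).
  + intros n. rewrite <- Rmult_minus_distr_l. apply Rmult_le_pos; [apply Rabs_pos|].
    enough (a ^ S n <= b ^ S n) by lra. apply pow_incr; lra.
- simpl (sin_ratio 1 t). rewrite Rmult_0_l, cos_0, Rmult_0_r, Rplus_0_r, Rabs_R1; ring.
Qed.

Lemma inv_sqrt_bounds (M : R) : 1 < M -> 0 < / sqrt M < 1.
Proof.
intros HM.
assert (1 < sqrt M) by (rewrite <- sqrt_1; apply sqrt_lt_1; lra).
split; [apply Rinv_0_lt_compat; lra|].
rewrite <- Rinv_1; apply Rinv_lt_contravar; lra.
Qed.

(** Intermediate value theorem: [sin_sum] vanishes at [r = 0] and is at least
    [r^2 = / M] at [r = / sqrt M]. *)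
Lemma curve_radius_sig (M : R) (HM : 1 < M) (t : R) :
  {r : R | 0 <= r <= / sqrt M /\ sin_sum r t = / M}.
Proof.
pose (rho := / sqrt M). fold rho.
(* The intermediate value theorem wants a function continuous on the whole
   line, hence the truncation of the argument to [[0, rho]]. *)
pose (clamp := fun x => Rmax 0 (Rmin x rho)).
assert (Hrho : 0 < rho < 1) by exact (inv_sqrt_bounds M HM).
assert (Hclamp : forall x, 0 <= clamp x <= rho).
{ intros x; unfold clamp, Rmax, Rmin; destruct (Rle_dec x rho), (Rle_dec 0 _); lra. }
assert (Hcont : continuity (fun x => sin_sum (clamp x) t)).
{ intros x. apply continuity_pt_filterlim.
  apply (filterlim_sin_sum (locally x) _ _ _ _ rho); try assumption; try apply Hclamp.
  - apply filter_forall, Hclamp.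
  - apply filterlim_R_eps; [apply locally_filter|]. intros eps Heps.
    exists (mkposreal eps Heps); intros y Hy.
    apply Rabs_def2 in Hy; unfold minus, plus, opp in Hy; simpl in Hy.
    apply Rabs_def1; unfold clamp, Rmax, Rmin;
      destruct (Rle_dec x rho), (Rle_dec y rho);
      repeat match goal with |- context [Rle_dec 0 ?z] => destruct (Rle_dec 0 z) end; lra.
  - apply filterlim_const. }
destruct (IVT_gen (fun x => sin_sum (clamp x) t) 0 rho (/ M) Hcont) as [r [_ Hr]].
- replace (clamp 0) with 0
    by (unfold clamp, Rmax, Rmin; destruct (Rle_dec 0 rho), (Rle_dec 0 _); lra).
  replace (clamp rho) with rho
    by (unfold clamp, Rmax, Rmin; destruct (Rle_dec rho rho), (Rle_dec 0 _); lra).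
  assert (H1 : / M <= sin_sum rho t).
  { replace (/ M) with (rho ^ 2); [apply sin_sum_ge_sqr; lra|].
    unfold rho. rewrite pow_inv. f_equal. apply pow2_sqrt; lra. }
  assert (H2 : 0 < / M) by (apply Rinv_0_lt_compat; lra).
  rewrite sin_sum_0, Rmin_left, Rmax_right; lra.
- exists (clamp r); split; [apply Hclamp|exact Hr].
Qed.

Definition curve_radius (M : R) (HM : 1 < M) (t : R) : R :=
  proj1_sig (curve_radius_sig M HM t).

Lemma curve_radius_eq (M : R) (HM : 1 < M) (t : R) :
  sin_sum (curve_radius M HM t) t = / M.
Proof. unfold curve_radius; destruct (curve_radius_sig M HM t); simpl; tauto. Qed.

Lemma curve_radius_bounds (M : R) (HM : 1 < M) (t : R) :
  0 < curve_radius M HM t <= / sqrt M.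
Proof.
generalize (curve_radius_eq M HM t).
unfold curve_radius; destruct (curve_radius_sig M HM t) as [r [Hr Er]]; simpl; intros E.
split; [|lra].
destruct (Req_dec r 0) as [Z|Z]; [|lra].
rewrite Z, sin_sum_0 in E. generalize (Rinv_0_lt_compat M); lra.
Qed.

Lemma curve_radius_lt_1 (M : R) (HM : 1 < M) (t : R) : curve_radius M HM t < 1.
Proof.
generalize (curve_radius_bounds M HM t) (inv_sqrt_bounds M HM); lra.
Qed.

(** The root of an equation that is strictly increasing in [r] and continuous in
    [t] varies continuously: for [a] on either side of the root at [t0], the sign of
    [sin_sum a t - / M] persists for [t] near [t0]. *)
Lemma continuous_curve_radius (M : R) (HM : 1 < M) (t0 : R) :
  continuous (curve_radius M HM) t0.
Proof.
set (rad := curve_radius M HM).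
assert (Hb : forall t, 0 < rad t <= / sqrt M) by (intros t; apply curve_radius_bounds).
assert (H1 := inv_sqrt_bounds M HM).
assert (Hlim : forall a, 0 < a < 1 ->
  filterlim (fun t => sin_sum a t) (locally t0) (locally (sin_sum a t0))).
{ intros a Ha. apply (filterlim_sin_sum (locally t0) _ _ _ _ a); try assumption; try lra.
  - apply filter_forall; intros; lra.
  - apply filterlim_const.
  - intros P HP; exact HP. }
apply filterlim_R_eps; [apply locally_filter|]; intros eps Heps.
assert (Hlow : locally t0 (fun t => rad t0 - eps < rad t)).
{ destruct (Rle_dec (rad t0 - eps) 0) as [L|L].
  - apply filter_forall; intros t; generalize (Hb t); lra.
  - assert (Ha : 0 < rad t0 - eps < 1) by (generalize (Hb t0); lra).
    assert (D : 0 < / M - sin_sum (rad t0 - eps) t0).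
    { rewrite <- (curve_radius_eq M HM t0); fold rad.
      enough (sin_sum (rad t0 - eps) t0 < sin_sum (rad t0) t0) by lra.
      apply sin_sum_lt; generalize (Hb t0); lra. }
    apply filter_imp with (2 := proj1 (filterlim_R_eps _ _ _) (Hlim _ Ha) _ D).
    intros t Ht; apply Rabs_def2 in Ht.
    apply Rnot_le_lt; intros [C|C].
    + generalize (sin_sum_lt (rad t) (rad t0 - eps) t).
      generalize (curve_radius_eq M HM t); fold rad. generalize (Hb t); lra.
    + generalize (curve_radius_eq M HM t); fold rad; rewrite C; lra. }
assert (Hup : locally t0 (fun t => rad t < rad t0 + eps)).
{ destruct (Rle_dec 1 (rad t0 + eps)) as [L|L].
  - apply filter_forall; intros t; generalize (Hb t); lra.
  - assert (Ha : 0 < rad t0 + eps < 1) by (generalize (Hb t0); lra).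
    assert (D : 0 < sin_sum (rad t0 + eps) t0 - / M).
    { rewrite <- (curve_radius_eq M HM t0); fold rad.
      enough (sin_sum (rad t0) t0 < sin_sum (rad t0 + eps) t0) by lra.
      apply sin_sum_lt; generalize (Hb t0); lra. }
    apply filter_imp with (2 := proj1 (filterlim_R_eps _ _ _) (Hlim _ Ha) _ D).
    intros t Ht; apply Rabs_def2 in Ht.
    apply Rnot_le_lt; intros [C|C].
    + generalize (sin_sum_lt (rad t0 + eps) (rad t) t).
      generalize (curve_radius_eq M HM t); fold rad. generalize (Hb t); lra.
    + generalize (curve_radius_eq M HM t); fold rad; rewrite <- C; lra. }
apply filter_imp with (2 := filter_and _ _ Hlow Hup).
intros t [Ht1 Ht2]; apply Rabs_def1; lra.
Qed.

(** Minus the linear coefficient of the series with constant term 1 that vanishes at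
    the point of angle [t] of the curve and whose coefficient of [z^(j+1)] is
    [M sign (sin (j t))] for [j >= 1], if no [sin (j t)] vanishes. *)
Definition curve_coeff (M : R) (HM : 1 < M) (e t : R) : R :=
  cos t / curve_radius M HM t + M * cos_sum e (curve_radius M HM t) t.

Lemma filterlim_curve_coeff (M : R) (HM : 1 < M) (F : (R -> Prop) -> Prop) {FF : Filter F}
  (e c : R) :
  Rabs e <= 1 -> filter_le F (locally c) ->
  (forall j, (0 < j)%nat -> filterlim (signed_cos 1 j) F (locally (signed_cos e j c))) ->
  filterlim (curve_coeff M HM 1) F (locally (curve_coeff M HM e c)).
Proof.
intros He HF Hj.
assert (Hr : filterlim (curve_radius M HM) F (locally (curve_radius M HM c))).
{ apply filterlim_filter_le_1 with (1 := HF), continuous_curve_radius. }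
assert (Hb : forall t, 0 <= curve_radius M HM t <= / sqrt M).
{ intros t; generalize (curve_radius_bounds M HM t); lra. }
unfold curve_coeff; apply filterlim_Rplus; [exact FF| |].
- apply filterlim_Rmult; [exact FF| |].
  + apply filterlim_filter_le_1 with (1 := HF), continuous_cos.
  + apply (filterlim_comp _ _ _ (curve_radius M HM) Rinv F (locally (curve_radius M HM c)));
      [exact Hr|].
    apply (ex_derive_continuous (K := R_AbsRing) (V := R_NormedModule) Rinv).
    auto_derive. generalize (curve_radius_bounds M HM c); lra.
- apply filterlim_Rmult; [exact FF|apply filterlim_const|].
  apply (filterlim_Series F (fun t n => signed_cos 1 (S n) t * curve_radius M HM t ^ S n)
           (fun n => (/ sqrt M) ^ S n)).
  + apply ex_series_cos_majorant, inv_sqrt_bounds, HM.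
  + apply filter_forall; intros t n; apply cos_term_le; [rewrite Rabs_R1; lra|apply Hb].
  + intros n; now apply cos_term_le.
  + intros n; apply filterlim_Rmult; [exact FF|apply Hj; lia|now apply filterlim_pow].
Qed.

(** At [t = 0] the curve reads [M (r / (1 - r))^2 = 1] and the coefficient is
    [/ r + M r / (1 - r)]. *)
Lemma curve_coeff_0 (M : R) (HM : 1 < M) : curve_coeff M HM 1 0 = 2 * sqrt M + 1.
Proof.
generalize (curve_radius_eq M HM 0) (curve_radius_bounds M HM 0) (curve_radius_lt_1 M HM 0).
unfold curve_coeff. set (r := curve_radius M HM 0). intros E Hr Hr1.
assert (HsM : 0 < sqrt M) by (apply sqrt_lt_R0; lra).
assert (HsM2 : sqrt M * sqrt M = M) by (apply sqrt_sqrt; lra).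
unfold sin_sum in E.
rewrite (Series_ext _ (fun n => INR n * r ^ S n)), Series_INR_pow in E.
2: lra.
2: { intros n; rewrite sin_ratio_0, Rabs_right; [reflexivity|]. apply Rle_ge, pos_INR. }
assert (Er : r / (1 - r) = / sqrt M).
{ assert (0 < r / (1 - r)) by (apply Rdiv_lt_0_compat; lra).
  apply Rsqr_inj; [lra|apply Rlt_le, Rinv_0_lt_compat; lra|].
  unfold Rsqr. rewrite <- Rinv_mult, HsM2. lra. }
assert (Hs : cos_sum 1 r 0 = r / (1 - r)).
{ unfold cos_sum. rewrite (Series_ext _ (fun n => r * r ^ n)).
  - rewrite Series_scal_l, Series_geom by (rewrite Rabs_right; lra). reflexivity.
  - intros n. unfold signed_cos. rewrite sin_ratio_0.
    assert (0 < INR (S n)) by (apply lt_0_INR; lia).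
    destruct (Req_EM_T (INR (S n)) 0); [lra|].
    rewrite sign_eq_1, Rmult_0_r, cos_0 by assumption; simpl; ring. }
assert (Er2 : / r = 1 + sqrt M).
{ apply Rmult_eq_reg_l with (r / (1 - r)); [|apply Rgt_not_eq, Rdiv_lt_0_compat; lra].
  rewrite Er at 2. rewrite Rmult_plus_distr_l, Rinv_l, <- Er by lra. field; lra. }
rewrite Hs, Er, cos_0. unfold Rdiv; rewrite Er2, Rmult_1_l.
rewrite <- HsM2 at 2; field; lra.
Qed.

(** Both [signed_cos 1 (n + 1)] and [|sin_ratio n|] are 1 at [PI / 2] for odd [n]
    and 0 for even [n]: the two sums agree term by term. *)
Lemma curve_coeff_PI2 (M : R) (HM : 1 < M) : curve_coeff M HM 1 (PI / 2) = 1.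
Proof.
unfold curve_coeff.
assert (E : cos_sum 1 (curve_radius M HM (PI / 2)) (PI / 2)
            = sin_sum (curve_radius M HM (PI / 2)) (PI / 2)).
{ apply Series_ext; intros n; f_equal.
  assert (Hsin : sin (INR n * (PI / 2)) = sin_ratio n (PI / 2))
    by (rewrite sin_ratio_spec, sin_PI2; ring).
  assert (Hrat : sin_ratio (S n) (PI / 2) = cos (INR n * (PI / 2)))
    by (simpl; rewrite cos_PI2; ring).
  assert (Hcos : cos (INR (S n) * (PI / 2)) = - sin_ratio n (PI / 2)).
  { rewrite S_INR, Rmult_plus_distr_r, Rmult_1_l, cos_plus, sin_PI2, cos_PI2, Hsin; ring. }
  assert (H0 : sin (INR n * (PI / 2)) * cos (INR n * (PI / 2)) = 0).
  { enough (sin (2 * (INR n * (PI / 2))) = 0) by (rewrite sin_2a in *; lra).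
    replace (2 * (INR n * (PI / 2))) with (INR n * PI) by field.
    rewrite INR_IZR_INZ. apply sin_eq_0_1; now exists (Z.of_nat n). }
  generalize (sin2_cos2 (INR n * (PI / 2))); unfold Rsqr; intros H1.
  unfold signed_cos. rewrite Hrat, Hcos. rewrite Hsin in *.
  destruct (Req_EM_T (cos (INR n * (PI / 2))) 0) as [Z|Z].
  - rewrite Z in H1.
    destruct (Rcase_abs (sin_ratio n (PI / 2)));
      [rewrite Rabs_left by assumption|rewrite Rabs_right by assumption]; nra.
  - replace (sin_ratio n (PI / 2)) with 0.
    + rewrite Rabs_R0; ring.
    + apply Rmult_integral in H0; destruct H0; [lra|contradiction]. }
rewrite E, curve_radius_eq, cos_PI2.
unfold Rdiv; rewrite Rmult_0_l, Rplus_0_l, Rinv_r; lra.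
Qed.

(** * The point of the curve with a prescribed linear coefficient *)

(** An intermediate value theorem for a function with upward jumps only, at the
    first angle where the coefficient descends to [k]. *)
Lemma curve_crossing (M : R) (HM : 1 < M) (k : R) :
  1 < k < 2 * sqrt M + 1 ->
  exists t, 0 < t <= PI / 2 /\ curve_coeff M HM 1 t = k /\
    forall j, (0 < j)%nat -> sin_ratio j t <> 0.
Proof.
intros Hk.
(* The supremum of [E] is the first angle at which the coefficient is at most [k]. *)
pose (E := fun x => 0 <= x <= PI / 2 /\ forall t, 0 <= t < x -> k < curve_coeff M HM 1 t).
assert (HPI := PI_RGT_0).
assert (E0 : E 0) by (split; [lra|intros t Ht; lra]).
destruct (completeness E) as [c [Hub Hlub]].
{ exists (PI / 2); intros x [Hx _]; lra. }
{ exists 0; exact E0. }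
assert (Hc : 0 <= c <= PI / 2).
{ split; [now apply Hub|]. apply Hlub; intros x [Hx _]; lra. }
assert (Hbelow : forall t, 0 <= t < c -> k < curve_coeff M HM 1 t).
{ intros t Ht. apply Rnot_le_lt; intros C.
  enough (c <= t) by lra. apply Hlub; intros x [_ Hx].
  apply Rnot_lt_le; intros Hlt. specialize (Hx t). lra. }
assert (Hle : curve_coeff M HM 1 c <= k).
{ apply Rnot_lt_le; intros C.
  assert (Hc2 : c < PI / 2).
  { destruct (Req_dec c (PI / 2)) as [Z|Z]; [|lra].
    rewrite Z, curve_coeff_PI2 in C; lra. }
  assert (Hlim : filterlim (curve_coeff M HM 1) (at_right c) (locally (curve_coeff M HM 1 c))).
  { apply (filterlim_curve_coeff M HM (at_right c)); [rewrite Rabs_R1; lra|apply filter_le_within|].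
    intros j Hj; apply filterlim_signed_cos_right; [exact Hj|lra]. }
  destruct (proj1 (filterlim_R_eps _ _ _) Hlim (curve_coeff M HM 1 c - k)) as [d Hd]; [lra|].
  assert (Hdp := cond_pos d).
  pose (x := Rmin (PI / 2) (c + d)).
  assert (Hx : c < x <= PI / 2 /\ x <= c + d).
  { unfold x; split; [split; [apply Rmin_glb_lt; lra|apply Rmin_l]|apply Rmin_r]. }
  enough (x <= c) by lra.
  apply Hub; split; [lra|]. intros t Ht.
  destruct (Rtotal_order t c) as [L|[L|L]]; [apply Hbelow; lra|now rewrite L|].
  assert (B : ball c d t).
  { apply Rabs_def1; unfold minus, plus, opp; simpl; lra. }
  specialize (Hd t B L). apply Rabs_def2 in Hd; lra. }
assert (Hc0 : 0 < c).
{ destruct (Req_dec c 0) as [Z|Z]; [|lra]. rewrite Z, curve_coeff_0 in Hle; lra. }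
assert (Hge : k <= curve_coeff M HM (-1) c).
{ assert (Hlim : filterlim (curve_coeff M HM 1) (at_left c) (locally (curve_coeff M HM (-1) c))).
  { apply (filterlim_curve_coeff M HM (at_left c));
      [rewrite Rabs_left; lra|apply filter_le_within|].
    intros j Hj; apply filterlim_signed_cos_left; [exact Hj|lra]. }
  apply Rnot_lt_le; intros C.
  destruct (proj1 (filterlim_R_eps _ _ _) Hlim (k - curve_coeff M HM (-1) c)) as [d Hd]; [lra|].
  assert (Hdp := cond_pos d).
  pose (t := Rmax (c / 2) (c - d / 2)).
  assert (Ht : 0 <= t < c /\ c - d < t).
  { unfold t, Rmax; destruct (Rle_dec (c / 2) (c - d / 2)); lra. }
  assert (B : ball c d t).
  { apply Rabs_def1; unfold minus, plus, opp; simpl; lra. }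
  specialize (Hd t B (proj2 (proj1 Ht))). apply Rabs_def2 in Hd.
  generalize (Hbelow t (proj1 Ht)); lra. }
assert (Hr := curve_radius_bounds M HM c). assert (Hr1 := curve_radius_lt_1 M HM c).
set (r := curve_radius M HM c) in *.
assert (A1 : Rabs 1 <= 1) by (rewrite Rabs_R1; lra).
assert (Am1 : Rabs (-1) <= 1) by (rewrite Rabs_left; lra).
assert (Ex1 := ex_cos_sum 1 r c A1 ltac:(lra)).
assert (Exm1 := ex_cos_sum (-1) r c Am1 ltac:(lra)).
assert (Hterm : forall n, 0 <= signed_cos 1 (S n) c * r ^ S n - signed_cos (-1) (S n) c * r ^ S n).
{ intros n. rewrite <- Rmult_minus_distr_r. apply Rmult_le_pos; [|apply pow_le; lra].
  unfold signed_cos; destruct (Req_EM_T (sin_ratio (S n) c) 0); lra. }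
assert (Hdiff : Series (fun n => signed_cos 1 (S n) c * r ^ S n - signed_cos (-1) (S n) c * r ^ S n)
                = cos_sum 1 r c - cos_sum (-1) r c) by now apply Series_minus.
assert (Hex : ex_series (fun n => signed_cos 1 (S n) c * r ^ S n - signed_cos (-1) (S n) c * r ^ S n)).
{ exact (ex_series_minus (K := R_AbsRing) (V := R_NormedModule) _ _ Ex1 Exm1). }
assert (Hpos := Series_nonneg _ Hex Hterm). rewrite Hdiff in Hpos.
unfold curve_coeff in Hle, Hge; fold r in Hle, Hge.
(* The value is at most [k], the left limit at least [k], and the value is never
   below the left limit: so they agree, and no term can jump. *)
assert (Heq : cos_sum 1 r c - cos_sum (-1) r c = 0) by nra.
exists c; split; [lra|split].
- unfold curve_coeff; fold r. nra.
- intros [|n] Hj Z; [lia|].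
  generalize (Series_nonneg_ge_term _ n Hex Hterm). rewrite Hdiff, Heq.
  unfold signed_cos; destruct (Req_EM_T (sin_ratio (S n) c) 0); [|contradiction].
  generalize (pow_lt r (S n)); lra.
Qed.

(** The point found by [curve_crossing], described by the sums of imaginary and
    real parts only. The terms of index 0 vanish, as [sign 0 = 0]. *)
Lemma exists_rigid_point (M k : R) :
  1 < M -> 1 < k < 2 * sqrt M + 1 ->
  exists r t, 0 < r < 1 /\ 0 < sin t /\
    (forall j, (0 < j)%nat -> sin (INR j * t) <> 0) /\
    is_series (fun j => r ^ j * Rabs (sin (INR j * t))) (sin t / r / M) /\
    is_series (fun j => r ^ j * (sign (sin (INR j * t)) * cos (INR j * t)))
      ((k - cos t / r) / M).
Proof.
intros HM Hk.
destruct (curve_crossing M HM k Hk) as [t [Ht [Hcoeff Hnz]]].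
assert (Hr := curve_radius_bounds M HM t). assert (Hr1 := curve_radius_lt_1 M HM t).
assert (Hsum := curve_radius_eq M HM t). unfold curve_coeff in Hcoeff.
set (r := curve_radius M HM t) in *.
assert (HPI := PI_RGT_0).
assert (Hst : 0 < sin t) by (apply sin_gt_0; lra).
exists r, t; split; [lra|split; [exact Hst|split; [|split]]].
- intros j Hj. rewrite sin_ratio_spec. apply Rmult_integral_contrapositive_currified; [lra|auto].
- apply is_series_ext_R with (fun j => (sin t / r) * (Rabs (sin_ratio j t) * r ^ S j)).
  + intros j. rewrite sin_ratio_spec, Rabs_mult, (Rabs_right (sin t)) by lra.
    simpl; field; lra.
  + apply is_series_scal_R. rewrite <- Hsum. apply Series_correct, ex_sin_sum; lra.
- apply is_series_shift_R.
  replace ((k - cos t / r) / M - _) with (cos_sum 1 r t).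
  + apply is_series_ext_R with (fun n => signed_cos 1 (S n) t * r ^ S n).
    * intros n; unfold signed_cos.
      assert (Z := Hnz (S n) ltac:(lia)).
      destruct (Req_EM_T (sin_ratio (S n) t) 0); [contradiction|].
      replace (sign (sin (INR (S n) * t))) with (sign (sin_ratio (S n) t)); [ring|].
      rewrite sin_ratio_spec, sign_mult, (sign_eq_1 (sin t) Hst); ring.
    * apply Series_correct, ex_cos_sum; [rewrite Rabs_R1; lra|lra].
  + simpl (INR 0). rewrite Rmult_0_l, sin_0, sign_0, <- Hcoeff. field; lra.
Qed.

(** * Power series at a point in polar form *)

(** Complex balls are here products of real balls. *)
Lemma is_series_C (w : nat -> Complex.C) (l : Complex.C) :
  @is_series C_AbsRing C_NormedModule w l <->
  is_series (fun n => fst (w n)) (fst l) /\ is_series (fun n => snd (w n)) (snd l).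
Proof.
assert (Hfst : forall N, fst (sum_n (G := C_NormedModule) w N)
                         = sum_n (G := R_NormedModule) (fun n => fst (w n)) N).
{ induction N as [|N IH]; [now rewrite !sum_O|]. rewrite !sum_Sn, <- IH; reflexivity. }
assert (Hsnd : forall N, snd (sum_n (G := C_NormedModule) w N)
                         = sum_n (G := R_NormedModule) (fun n => snd (w n)) N).
{ induction N as [|N IH]; [now rewrite !sum_O|]. rewrite !sum_Sn, <- IH; reflexivity. }
split.
- intros H; split; apply filterlim_locally; intros eps;
    generalize (proj1 (filterlim_locally _ _) H eps); apply filter_imp; intros N [H1 H2].
  + now rewrite <- Hfst.
  + now rewrite <- Hsnd.
- intros [H1 H2]. apply (filterlim_locally (U := C_UniformSpace)); intros eps.
  generalize (filter_and _ _ (proj1 (filterlim_locally _ _) H1 eps)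
                (proj1 (filterlim_locally _ _) H2 eps)).
  apply filter_imp; intros N [B1 B2]; split.
  + now rewrite Hfst.
  + now rewrite Hsnd.
Qed.

Definition polar (r t : R) : Complex.C := (r * cos t, r * sin t).

Lemma pow_n_polar (r t : R) (n : nat) :
  pow_n (K := C_AbsRing) (polar r t) n = (r ^ n * cos (INR n * t), r ^ n * sin (INR n * t)).
Proof.
induction n as [|n IH].
- simpl. rewrite Rmult_0_l, cos_0, sin_0, Rmult_0_r, Rmult_1_l; reflexivity.
- change (pow_n (K := C_AbsRing) (polar r t) (S n))
    with (Cmult (polar r t) (pow_n (K := C_AbsRing) (polar r t) n)).
  rewrite IH, S_INR. replace ((INR n + 1) * t) with (INR n * t + t) by ring.
  rewrite cos_plus, sin_plus. unfold Cmult, polar; simpl. f_equal; ring.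
Qed.

Lemma Cmod_polar (r t : R) : 0 <= r -> Cmod (polar r t) = r.
Proof.
intros Hr. unfold Cmod, polar; simpl.
replace (r * cos t * (r * cos t * 1) + r * sin t * (r * sin t * 1)) with (r ^ 2).
- now apply sqrt_pow2.
- generalize (sin2_cos2 t); unfold Rsqr; intros E.
  transitivity (r ^ 2 * (sin t * sin t + cos t * cos t)); [rewrite E|]; ring.
Qed.

Lemma is_pseries_polar (a : nat -> R) (r t : R) :
  @is_pseries C_AbsRing C_NormedModule (fun n => RtoC (a n)) (polar r t) (RtoC 0) <->
  is_series (fun n => a n * (r ^ n * cos (INR n * t))) 0 /\
  is_series (fun n => a n * (r ^ n * sin (INR n * t))) 0.
Proof.
unfold is_pseries; rewrite is_series_C.
assert (E1 : forall n, fst (scal (V := C_NormedModule) (pow_n (K := C_AbsRing) (polar r t) n) (RtoC (a n)))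
               = a n * (r ^ n * cos (INR n * t))).
{ intros n. rewrite pow_n_polar. unfold scal; simpl. unfold mult; simpl; ring. }
assert (E2 : forall n, snd (scal (V := C_NormedModule) (pow_n (K := C_AbsRing) (polar r t) n) (RtoC (a n)))
               = a n * (r ^ n * sin (INR n * t))).
{ intros n. rewrite pow_n_polar. unfold scal; simpl. unfold mult; simpl; ring. }
split; intros [H1 H2]; split.
- exact (is_series_ext _ _ _ E1 H1).
- exact (is_series_ext _ _ _ E2 H2).
- exact (is_series_ext _ _ _ (fun n => eq_sym (E1 n)) H1).
- exact (is_series_ext _ _ _ (fun n => eq_sym (E2 n)) H2).
Qed.

Lemma Sigma_polar (S : Ensemble Z) (r t : R) : 0 <= r < 1 ->
  In Complex.C (Sigma (Zset_C S)) (polar r t) <->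
  exists a : nat -> R, (forall n, In R (Zset_R S) (a n)) /\ a 0%nat <> 0 /\
    is_series (fun n => a n * (r ^ n * cos (INR n * t))) 0 /\
    is_series (fun n => a n * (r ^ n * sin (INR n * t))) 0.
Proof.
intros Hr; split.
- intros [_ [p [Hp [Hp0 Hser]]]].
  exists (fun n => Re (p n)).
  assert (Hre : forall n, p n = RtoC (Re (p n))).
  { intros n; destruct (Hp n) as [m _ y Hy]; rewrite Hy; reflexivity. }
  split; [|split].
  + intros n; destruct (Hp n) as [m Hm y Hy]; rewrite Hy. now apply Im_def.
  + intros Z; apply Hp0. now rewrite Hre, Z.
  + apply is_pseries_polar.
    apply is_series_ext with (2 := Hser). intros n; now rewrite <- Hre.
- intros [a [Ha [Ha0 Hser]]]; split; [rewrite Cmod_polar; lra|].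
  exists (fun n => RtoC (a n)); split; [|split].
  + intros n. destruct (Ha n) as [m Hm y Hy]; rewrite Hy.
    now apply (Im_def _ _ S (fun n => RtoC (IZR n))).
  + intros Z; apply Ha0. now injection Z.
  + now apply is_pseries_polar.
Qed.

(** * Recovering the digits from the zeros *)

Lemma symmetric_opp (S : Ensemble Z) (n : Z) : symmetric S -> In Z S n -> In Z S (- n)%Z.
Proof. intros [_ H] Hn. apply H. now apply Im_def. Qed.

Lemma symmetric_abs_le (S : Ensemble Z) (m : Z) (x : R) :
  symmetric S -> is_max S m -> In R (Zset_R S) x -> Rabs x <= IZR m.
Proof.
intros Hsym [_ Hmax] [n Hn y Hy]; rewrite Hy.
generalize (Hmax _ Hn) (Hmax _ (symmetric_opp S n Hsym Hn)); intros H1 H2.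
apply IZR_le in H1; apply IZR_le in H2; rewrite opp_IZR in H2.
apply Rabs_le; lra.
Qed.

Lemma Zset_R_IZR (S : Ensemble Z) (n : Z) : In R (Zset_R S) (IZR n) <-> In Z S n.
Proof.
split; [|now apply Im_def].
intros H; inversion H as [m Hm y Hy]. apply eq_IZR in Hy; now subst.
Qed.

(** The point [1 / (m + 1)] is a zero of [1 - m z - m z^2 - ...], while digits
    bounded by [n] give [|p_0| <= n r / (1 - r) = n / m] there. *)
Lemma Sigma_max_le (A B : Ensemble Z) (m n : Z) :
  symmetric A -> symmetric B -> normalized (Zset_R A) -> normalized (Zset_R B) ->
  is_max A m -> is_max B n ->
  Included Complex.C (Sigma (Zset_C A)) (Sigma (Zset_C B)) -> (m <= n)%Z.
Proof.
intros HA HB [_ [_ [A1 _]]] [_ [_ [_ B1]]] Hm Hn Hinc.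
assert (Hm1 : 1 <= IZR m).
{ generalize (symmetric_abs_le A m 1 HA Hm A1); rewrite Rabs_R1; lra. }
pose (r := / (IZR m + 1)).
assert (Hr : 0 < r < 1).
{ unfold r; split; [apply Rinv_0_lt_compat; lra|].
  rewrite <- Rinv_1; apply Rinv_lt_contravar; lra. }
assert (Hg : is_series (fun n => r ^ S n) (/ IZR m)).
{ replace (/ IZR m) with (r * / (1 - r)) by (unfold r; field; lra).
  apply is_series_scal_R, is_series_geom. rewrite Rabs_right; lra. }
assert (Hin : In Complex.C (Sigma (Zset_C A)) (polar r 0)).
{ apply Sigma_polar; [lra|].
  exists (fun j => match j with O => 1 | S _ => - IZR m end).
  split; [|split; [lra|split]].
  - intros [|j]; [exact A1|]. rewrite <- opp_IZR.
    apply Zset_R_IZR, symmetric_opp; [exact HA|apply Hm].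
  - apply is_series_shift_R.
    replace (0 - _) with (- IZR m * / IZR m).
    + apply is_series_ext_R with (fun j => - IZR m * r ^ S j).
      * intros j; rewrite Rmult_0_r, cos_0; ring.
      * now apply is_series_scal_R.
    + rewrite Rmult_0_r, cos_0; simpl; field; lra.
  - apply is_series_ext_R with (fun j => 0 * r ^ j).
    + intros j; rewrite Rmult_0_r, sin_0; ring.
    + assert (Hg0 : is_series (fun j => 0 * r ^ j) (0 * / (1 - r))).
      { apply is_series_scal_R, is_series_geom. rewrite Rabs_right; lra. }
      now rewrite Rmult_0_l in Hg0. }
apply Hinc, Sigma_polar in Hin; [|lra].
destruct Hin as [b [Hb [Hb0 [Hser _]]]].
apply is_series_shift_R in Hser.
assert (E : Series (fun j => b (S j) * r ^ S j) = - b 0%nat).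
{ apply is_series_unique. revert Hser; rewrite Rmult_0_r, cos_0, pow_O.
  replace (0 - b 0%nat * (1 * 1)) with (- b 0%nat) by ring.
  apply is_series_ext_R; intros j; rewrite Rmult_0_r, cos_0; ring. }
assert (Hbound : Rabs (Series (fun j => b (S j) * r ^ S j)) <= IZR n * / IZR m).
{ assert (Hmaj : is_series (fun j => IZR n * r ^ S j) (IZR n * / IZR m))
    by now apply is_series_scal_R.
  assert (Hle : forall j, Rabs (b (S j) * r ^ S j) <= IZR n * r ^ S j).
  { intros j. rewrite Rabs_mult, (Rabs_right (r ^ S j)).
    - apply Rmult_le_compat_r; [apply pow_le; lra|]. now apply (symmetric_abs_le B).
    - apply Rle_ge, pow_le; lra. }
  rewrite <- (is_series_unique _ _ Hmaj).
  eapply Rle_trans; [apply Series_Rabs|apply Series_le].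
  - apply ex_series_abs_le with (fun j => IZR n * r ^ S j); [now eexists; exact Hmaj|].
    intros j; now rewrite Rabs_Rabsolu.
  - intros j; split; [apply Rabs_pos|apply Hle].
  - now eexists; exact Hmaj. }
rewrite E, Rabs_Ropp in Hbound.
specialize (B1 _ (Hb 0%nat) Hb0).
apply le_IZR. apply Rmult_le_reg_r with (/ IZR m); [apply Rinv_0_lt_compat; lra|].
rewrite Rinv_r; lra.
Qed.

(** Multiplication of the complex series by [r e^(i t)], in real and imaginary parts. *)
Lemma is_series_rotate (b : nat -> R) (r t A B : R) :
  is_series (fun n => b n * (r ^ n * cos (INR n * t))) A ->
  is_series (fun n => b n * (r ^ n * sin (INR n * t))) B ->
  is_series (fun n => b n * (r ^ S n * cos (INR (S n) * t))) (r * cos t * A - r * sin t * B) /\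
  is_series (fun n => b n * (r ^ S n * sin (INR (S n) * t))) (r * cos t * B + r * sin t * A).
Proof.
intros HA HB.
assert (E : forall n, INR (S n) * t = INR n * t + t) by (intros n; rewrite S_INR; ring).
split.
- replace (r * cos t * A - r * sin t * B) with (r * cos t * A + - (r * sin t) * B) by ring.
  eapply is_series_ext_R;
    [|exact (is_series_plus_R _ _ _ _ (is_series_scal_R (r * cos t) _ _ HA)
               (is_series_scal_R (- (r * sin t)) _ _ HB))].
  intros n; rewrite E, cos_plus; simpl; ring.
- eapply is_series_ext_R;
    [|exact (is_series_plus_R _ _ _ _ (is_series_scal_R (r * cos t) _ _ HB)
               (is_series_scal_R (r * sin t) _ _ HA))].
  intros n; rewrite E, sin_plus; simpl; ring.
Qed.

Lemma is_series_unrotate (b : nat -> R) (r t A B : R) : r <> 0 ->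
  is_series (fun n => b n * (r ^ S n * cos (INR (S n) * t))) A ->
  is_series (fun n => b n * (r ^ S n * sin (INR (S n) * t))) B ->
  is_series (fun n => b n * (r ^ n * cos (INR n * t))) ((cos t * A + sin t * B) / r) /\
  is_series (fun n => b n * (r ^ n * sin (INR n * t))) ((cos t * B - sin t * A) / r).
Proof.
intros Hr HA HB.
assert (E : forall n, INR (S n) * t = INR n * t + t) by (intros n; rewrite S_INR; ring).
assert (T : forall x, x = x * (sin t * sin t + cos t * cos t)).
{ intros x; generalize (sin2_cos2 t); unfold Rsqr; intros ->; ring. }
split.
- replace ((cos t * A + sin t * B) / r) with (cos t / r * A + sin t / r * B) by (field; exact Hr).
  eapply is_series_ext_R;
    [|exact (is_series_plus_R _ _ _ _ (is_series_scal_R (cos t / r) _ _ HA)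
               (is_series_scal_R (sin t / r) _ _ HB))].
  intros n; cbv beta; rewrite E, cos_plus, sin_plus, (T (b n * (r ^ n * cos (INR n * t)))).
  simpl; field; exact Hr.
- replace ((cos t * B - sin t * A) / r) with (cos t / r * B + - (sin t / r) * A)
    by (field; exact Hr).
  eapply is_series_ext_R;
    [|exact (is_series_plus_R _ _ _ _ (is_series_scal_R (cos t / r) _ _ HB)
               (is_series_scal_R (- (sin t / r)) _ _ HA))].
  intros n; cbv beta; rewrite E, cos_plus, sin_plus, (T (b n * (r ^ n * sin (INR n * t)))).
  simpl; field; exact Hr.
Qed.

(** The point of [exists_rigid_point] is a zero of
    [1 - k z + m sum_(j >= 1) sign (sin (j t)) z^(j+1)], with digits in [A]. The
    extremal equation makes this series, up to sign, the only one with digits in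
    [B] that vanishes there. *)
Lemma Sigma_transfer (A B : Ensemble Z) (m k : Z) :
  symmetric A -> symmetric B -> normalized (Zset_R A) -> normalized (Zset_R B) ->
  is_max A m -> is_max B m ->
  Included Complex.C (Sigma (Zset_C A)) (Sigma (Zset_C B)) ->
  1 < IZR k < 2 * sqrt (IZR m) + 1 -> In Z A k -> In Z B k.
Proof.
intros HA HB [_ [_ [A1 _]]] [_ [_ [_ B1]]] HmA HmB Hinc Hk HkA.
assert (HM : 1 < IZR m).
{ apply Rlt_le_trans with (IZR k); [lra|]. apply IZR_le, HmA, HkA. }
destruct (exists_rigid_point (IZR m) (IZR k) HM Hk)
  as [r [t [Hr [Hst [Hnz [Hsin Hcos]]]]]].
set (M := IZR m) in *. set (x := IZR k) in *.
pose (s := fun j => sign (sin (INR j * t))).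
assert (Hs : forall j, (0 < j)%nat -> s j = 1 \/ s j = -1).
{ intros j Hj. destruct (sign_cases _ (Hnz j Hj)) as [[_ E]|[_ E]]; unfold s; auto. }
assert (Habs : forall j, Rabs (sin (INR j * t)) = s j * sin (INR j * t)).
{ intros j; unfold s. destruct (Req_dec (sin (INR j * t)) 0) as [Z|Z].
  - rewrite Z, Rabs_R0; ring.
  - destruct (sign_cases _ Z) as [[P E]|[P E]]; rewrite E.
    + rewrite Rabs_right; lra.
    + rewrite Rabs_left; lra. }
assert (Hin : In Complex.C (Sigma (Zset_C A)) (polar r t)).
{ apply Sigma_polar; [lra|].
  pose (b := fun j => match j with O => - x | S _ => M * s j end).
  exists (fun j => match j with O => 1 | S i => b i end).
  split; [|split; [lra|]].
  - intros [|[|j]]; [exact A1| |].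
    + simpl. unfold x. rewrite <- opp_IZR. now apply Zset_R_IZR, symmetric_opp.
    + unfold b. destruct (Hs (S j) ltac:(lia)) as [E|E]; rewrite E.
      * rewrite Rmult_1_r. apply Zset_R_IZR, HmA.
      * replace (M * -1) with (IZR (- m)) by (rewrite opp_IZR; unfold M; ring).
        apply Zset_R_IZR, symmetric_opp; [exact HA|apply HmA].
  - assert (Hbc : is_series (fun j => b j * (r ^ j * cos (INR j * t))) (- (cos t / r))).
    { apply is_series_shift_R.
      apply is_series_shift_R, (is_series_scal_R M) in Hcos.
      replace (- (cos t / r) - _) with
        (M * ((x - cos t / r) / M - r ^ 0 * (sign (sin (INR 0 * t)) * cos (INR 0 * t)))).
      - revert Hcos; apply is_series_ext_R; intros j; unfold b, s; ring.
      - simpl. rewrite Rmult_0_l, sin_0, sign_0, cos_0. field; lra. }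
    assert (Hbs : is_series (fun j => b j * (r ^ j * sin (INR j * t))) (sin t / r)).
    { apply (is_series_scal_R M) in Hsin.
      replace (M * (sin t / r / M)) with (sin t / r) in Hsin by (field; lra).
      revert Hsin; apply is_series_ext_R; intros [|j].
      - simpl; rewrite Rmult_0_l, sin_0, Rabs_R0; ring.
      - rewrite Habs; unfold b; ring. }
    destruct (is_series_rotate b r t _ _ Hbc Hbs) as [H1 H2].
    generalize (sin2_cos2 t); unfold Rsqr; intros E.
    split; apply is_series_shift_R.
    + replace (0 - _) with (r * cos t * - (cos t / r) - r * sin t * (sin t / r)); [exact H1|].
      simpl; rewrite Rmult_0_l, cos_0.
      transitivity (- (sin t * sin t + cos t * cos t)); [field; lra|rewrite E; ring].
    + replace (0 - _) with (r * cos t * (sin t / r) + r * sin t * - (cos t / r)); [exact H2|].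
      simpl; rewrite Rmult_0_l, sin_0. field; lra. }
apply Hinc, Sigma_polar in Hin; [|lra].
destruct Hin as [a [Ha [Ha0 [Hac Has]]]].
pose (b := fun j => a (S j)).
apply is_series_shift_R in Hac, Has.
destruct (is_series_unrotate b r t _ _ ltac:(lra) Hac Has) as [Hbc Hbs].
clear Hac Has. simpl (INR 0) in Hbc, Hbs. rewrite Rmult_0_l, cos_0, sin_0, pow_O in Hbc, Hbs.
replace ((cos t * (0 - a 0%nat * (1 * 0)) - sin t * (0 - a 0%nat * (1 * 1))) / r)
  with (a 0%nat * (sin t / r)) in Hbs by (field; lra).
replace ((cos t * (0 - a 0%nat * (1 * 1)) + sin t * (0 - a 0%nat * (1 * 0))) / r)
  with (- a 0%nat * (cos t / r)) in Hbc by (field; lra).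
assert (Ha0' := B1 _ (Ha 0%nat) Ha0).
pose (e := sign (a 0%nat)).
assert (He : (e = 1 \/ e = -1) /\ Rabs (a 0%nat) = e * a 0%nat).
{ unfold e. destruct (sign_cases _ Ha0) as [[P E]|[P E]]; rewrite E.
  - rewrite Rabs_right by lra; split; [now left|ring].
  - rewrite Rabs_left by lra; split; [now right|ring]. }
destruct He as [He Hea].
assert (Hbb : forall j, Rabs (b j) <= M) 
  by (intros j; exact (symmetric_abs_le B m _ HB HmB (Ha (S j)))).
(* The defect of the triangle inequality, term by term; its sum is
   [(1 - |a 0|) sin t / r <= 0], so all terms vanish. *)
pose (gap := fun j => r ^ j * (M * Rabs (sin (INR j * t)) - e * b j * sin (INR j * t))).
assert (Hgap : is_series gap ((1 - Rabs (a 0%nat)) * (sin t / r))).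
{ replace ((1 - Rabs (a 0%nat)) * (sin t / r))
    with (M * (sin t / r / M) + (- e) * (a 0%nat * (sin t / r)))
    by (rewrite Hea; field; lra).
  eapply is_series_ext_R;
    [|exact (is_series_plus_R _ _ _ _ (is_series_scal_R M _ _ Hsin)
               (is_series_scal_R (- e) _ _ Hbs))].
  intros j; unfold gap; simpl; ring. }
assert (Hgap0 : forall j, 0 <= gap j).
{ intros j; unfold gap. apply Rmult_le_pos; [apply pow_le; lra|].
  enough (e * b j * sin (INR j * t) <= M * Rabs (sin (INR j * t))) by lra.
  eapply Rle_trans; [apply Rle_abs|].
  rewrite !Rabs_mult. apply Rmult_le_compat_r; [apply Rabs_pos|].
  replace (Rabs e) with 1; [rewrite Rmult_1_l; apply Hbb|].
  destruct He as [E|E]; rewrite E; [rewrite Rabs_R1|rewrite Rabs_left]; lra. }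
assert (Hex : ex_series gap) by (eexists; exact Hgap).
assert (Hstr : 0 < sin t / r) by (apply Rdiv_lt_0_compat; lra).
assert (Ha1 : Rabs (a 0%nat) = 1).
{ generalize (Series_nonneg _ Hex Hgap0). rewrite (is_series_unique _ _ Hgap). nra. }
assert (Hbj : forall j, (0 < j)%nat -> e * b j = M * s j).
{ intros j Hj.
  generalize (Series_nonneg_ge_term _ j Hex Hgap0) (Hgap0 j).
  rewrite (is_series_unique _ _ Hgap), Ha1; unfold gap; intros H1 H2.
  assert (Hz : r ^ j * (sin (INR j * t) * (M * s j - e * b j)) = 0)
    by (rewrite Habs in H1, H2; lra).
  apply Rmult_integral in Hz; destruct Hz as [Hz|Hz].
  - exfalso; revert Hz; apply pow_nonzero; lra.
  - apply Rmult_integral in Hz; destruct Hz as [Hz|Hz]; [destruct (Hnz j Hj Hz)|lra]. }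
(* Real parts: beyond index 0, [e b] and [M s] agree, so the terms of
   index 0 account for the difference of the sums. *)
assert (Hb0 : e * b 0%nat = - x).
{ apply is_series_shift_R, (is_series_scal_R M) in Hcos.
  apply (is_series_scal_R e), is_series_shift_R in Hbc.
  assert (U : e * (- a 0%nat * (cos t / r)) - e * (b 0%nat * (r ^ 0 * cos (INR 0 * t)))
    = M * ((x - cos t / r) / M - r ^ 0 * (sign (sin (INR 0 * t)) * cos (INR 0 * t)))).
  { rewrite <- (is_series_unique _ _ Hcos), <- (is_series_unique _ _ Hbc).
    apply Series_ext; intros j.
    transitivity (e * b (S j) * (r ^ S j * cos (INR (S j) * t))); [ring|].
    rewrite Hbj by lia; unfold s; ring. }
  simpl in U. rewrite Rmult_0_l, sin_0, sign_0, cos_0 in U.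
  replace (e * (- a 0%nat * (cos t / r))) with (- (cos t / r)) in U
    by (transitivity (- (e * a 0%nat) * (cos t / r)); [rewrite <- Hea, Ha1|]; ring).
  replace (M * ((x - cos t / r) / M - 1 * (0 * 1))) with (x - cos t / r) in U by (field; lra).
  lra. }
assert (Hn : exists n, In Z B n /\ b 0%nat = IZR n).
{ unfold b; destruct (Ha 1%nat) as [n Hn y Hy]; now exists n. }
destruct Hn as [n [Hn Hbn]]; rewrite Hbn in Hb0.
assert (Hnk : n = k \/ n = (- k)%Z).
{ destruct He as [E|E]; rewrite E in Hb0; [right|left]; apply eq_IZR;
    rewrite ?opp_IZR; fold x; lra. }
destruct Hnk as [->| ->]; [exact Hn|].
rewrite <- (Z.opp_involutive k). now apply symmetric_opp.
Qed.

Theorem theorem6p2 (S T : Ensemble Z)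
  (S_finite : Finite_sets.Finite Z S) (S_nonempty : Inhabited Z S)
  (S_symmetric : symmetric S) (S_normalized : normalized (Zset_R S))
  (T_finite : Finite_sets.Finite Z T) (T_nonempty : Inhabited Z T)
  (T_symmetric : symmetric T) (T_normalized : normalized (Zset_R T))
  (maxS : Z) (maxS_is_max : is_max S maxS)
  (Sigma_eq : Same_set C (Sigma (Zset_C S)) (Sigma (Zset_C T)))
  (k : Z) (k_lower : 1 < IZR k) (k_upper : IZR k < 2 * sqrt (IZR maxS) + 1) :
  In Z S k <-> In Z T k.
Proof.
destruct Sigma_eq as [Hst Hts].
destruct (is_max_exists_unique T T_finite T_nonempty) as [maxT [maxT_is_max _]].
assert (maxT = maxS) as ->.
{ apply Z.le_antisymm.
  - now apply (Sigma_max_le T S).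
  - now apply (Sigma_max_le S T). }
split.
- now apply (Sigma_transfer S T maxS).
- now apply (Sigma_transfer T S maxS).
Qed.
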